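(* Let $n\ge1$. Let $D$ be a weighted oriented cycle with underlying graph the cycle $C_{2n+1}=(x_1,\dots,x_{2n+1})$, with $V^+\neq\emptyset$ and such that all elements of $V^+$ are sinks, and let $\tilde I=I(D)$ be its edge ideal. Then for every $s\in\mathbb{N}$, $s\ge 1$, $$\mathrm{reg}\,\tilde I^{(s)}\le\mathrm{reg}\,\tilde I^{\,s}.$$
   Context: A weighted oriented graph $D=(V(D),E(D),w)$ consists of a finite simple graph $G$ (the underlying graph) with $V(G)=V(D)$, an orientation of each edge of $G$ (the pair $(x_i,x_j)\in E(D)$ denotes the edge directed from $x_i$ to $x_j$), and a weight function $w:V(D)\to\mathbb{N}=\{1,2,\dots\}$. If $x$ is a source (only arrows leaving $x$), one always assumes $w(x)=1$. Set $V^+=\{x\in V(D): w(x)\neq 1\}$. A vertex $x$ is a sink if all edges at $x$ are directed into $x$. Here $R=K[x_1,\dots,x_{2n+1}]$ with $K$ a field, with the standard grading (vertices are identified with variables). The edge ideal of $D$ is $I(D)=(x_ix_j^{w(x_j)} : (x_i,x_j)\in E(D))\subseteq R$. For a homogeneous ideal $I\subset R$, the $m$-th symbolic power is $I^{(m)}=\bigcap_{p\in \mathrm{Ass}(I)}(I^mR_p\cap R)$, the intersection being over all associated primes of $I$. $\mathrm{reg}$ denotes Castelnuovo–Mumford regularity: for a nonzero finitely generated graded $R$-module $M$, $\mathrm{reg}\,M=\max_{0\le i\le\dim M}\{a_i(M)+i\}$, where $a_i(M)=\max\{j\in\mathbb{Z}:[H^i_{\mathfrak m}(M)]_j\neq0\}$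 ($-\infty$ if $H^i_{\mathfrak m}(M)=0$) and $\mathfrak m=(x_1,\dots,x_{2n+1})$. *)

(* Defs.v *)
From HB Require Import structures.
From mathcomp Require Import all_boot all_order all_algebra.
(* mpoly has to be imported before constructive_ereal: their notations clash in
   the other order. *)
From mathcomp Require Import mpoly.
From mathcomp Require Import boolp classical_sets constructive_ereal.

Set Implicit Arguments.
Unset Strict Implicit.
Unset Printing Implicit Defensive.

Import Order.TTheory GRing.Theory Num.Theory.
Local Open Scope classical_set_scope.
Local Open Scope ring_scope.

(* Unlike idealr_closed of ring_quotient, the unit ideal is allowed. *)
Definition is_ideal (R : comNzRingType) (I : set R) : Prop :=
  [/\ I 0, forall x y, I x -> I y -> I (x + y) & forall a x, I x -> I (a * x)].

Definition is_prime_ideal (R : comNzRingType) (p : set R) : Prop :=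
  [/\ is_ideal p, ~ p 1 & forall x y, p (x * y) -> p x \/ p y].

Definition ideal_gen (R : comNzRingType) (G : set R) : set R :=
  smallest (@is_ideal R) G.

Definition ideal_power (R : comNzRingType) (I : set R) (m : nat) : set R :=
  ideal_gen [set \prod_(k < m) f k | f in [set f : 'I_m -> R | forall k, I (f k)]].

Definition ideal_colon (R : comNzRingType) (I : set R) (f : R) : set R :=
  [set x | I (x * f)].

(* Ass(I) stands for the set of associated primes of the module R/I. *)
Definition Ass (R : comNzRingType) (I : set R) : set (set R) :=
  [set p | is_prime_ideal p /\ exists f, p = ideal_colon I f].

(* J R_p, for a domain R, as a subset of Frac(R). *)
Definition loc_ideal (R : idomainType) (J p : set R) : set {fraction R} :=
  [set x | exists g u, [/\ J g, ~ p u & x = tofrac g / tofrac u]].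

Definition symbolic_power (R : idomainType) (I : set R) (m : nat) : set R :=
  \bigcap_(p in Ass I) (@tofrac R @^-1` loc_ideal (ideal_power I m) p).

(* The maximum of A if there is one, -oo if A is empty (and +oo if the integers
   in A are not bounded above). *)
Definition supz (A : set (\bar int)) : \bar int := supremum -oo%E A.

Lemma supz_max (A : set (\bar int)) m :
  A m -> (forall x, A x -> (x <= m)%E) -> supz A = m.
Proof.
move=> Am ub_m; rewrite /supz /supremum ifF; last first.
  by apply/negP => /eqP A0; rewrite A0 in Am.
have supm : supremums A m by split=> [x /ub_m//|y]; apply.
by case: xgetP => [y _ supy|/(_ m)//]; apply: (is_subset1_supremums supy supm).
Qed.

Lemma supz_set0 : supz set0 = -oo%E.
Proof. exact: supremum0. Qed.

Definition ann (R : comNzRingType) (I : set R) : set R :=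
  [set x | forall f, I f -> x * f = 0].

Definition prime_chain (R : comNzRingType) (J : set R) (l : nat)
    (p : nat -> set R) : Prop :=
  (forall k, (k <= l)%N -> is_prime_ideal (p k) /\ J `<=` p k) /\
  (forall k, (k < l)%N -> p k `<` p k.+1).

(* The dimension of I as an R-module, i.e. the Krull dimension of R / Ann(I). *)
Definition module_dim (R : comNzRingType) (I : set R) : \bar int :=
  supz [set (l%:Z)%:E | l in [set l | exists p, prime_chain (ann I) l p]].

(** Graded local cohomology of a homogeneous ideal I of R = K[x_0,...,x_(N-1)],
    viewed as a graded R-module, with support in m = (x_0,...,x_(N-1)): the
    cohomology of the Cech complex
      0 -> I -> (+)_i I_{x_i} -> (+)_(i<j) I_{x_i x_j} -> ... -> I_{x_0...x_(N-1)}
    where x_S is the product of the x_i with i in S. Since R is a domain, I_{x_S}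
    is a submodule of Frac(R). *)

Section LocalCohomology.
Variables (K : fieldType) (N : nat).
Local Notation R := {mpoly K[N]}.
Implicit Types (I : set R) (S T : {set 'I_N}) (i : nat) (j : int).

Definition xprod S : R := \prod_(i in S) 'X_i.

(* The degree j part of I_{x_S}: the fractions f / x_S ^ k with f in I
   homogeneous of degree j + k |S|. *)
Definition cech_loc I S j : set {fraction R} :=
  [set u | exists f (d k : nat),
     [/\ I f, f \is d.-homog, d%:Z = j + (k * #|S|)%N%:Z
       & u = tofrac f / tofrac (xprod S) ^+ k]].

(* The degree j part of the i-th term of the Cech complex: families indexed by
   all subsets S, vanishing unless |S| = i. *)
Definition cech I i j : set ({set 'I_N} -> {fraction R}) :=
  [set c | forall S, if #|S| == i then cech_loc I S j (c S) else c S = 0].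

Definition cech_diff (c : {set 'I_N} -> {fraction R}) :
    {set 'I_N} -> {fraction R} :=
  fun T => \sum_(t in T) (-1) ^+ #|[set u in T | (u < t)%N]| * c (T :\ t)%SET.

Definition cech_cocycles I i j : set ({set 'I_N} -> {fraction R}) :=
  [set c | cech I i j c /\ forall T, cech_diff c T = 0].

Definition cech_coboundaries I i j : set ({set 'I_N} -> {fraction R}) :=
  if i is k.+1 then cech_diff @` cech I k j else [set fun=> 0].

(* The degree j part of H^i_m(I) is not zero. *)
Definition loc_cohom_neq0 I i j : Prop :=
  ~ (cech_cocycles I i j `<=` cech_coboundaries I i j).

Definition a_inv I i : \bar int :=
  supz [set j%:E | j in [set j : int | loc_cohom_neq0 I i j]].

Definition reg I : \bar int :=
  supz [set (a_inv I i + (i%:Z)%:E)%E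
       | i in [set i : nat | ((i%:Z)%:E <= module_dim I)%E]].

End LocalCohomology.

Record worgraph (V : finType) := WOrGraph {
  arc : rel V;
  weight : V -> nat;
  (* x = y excludes loops, x != y excludes pairs of opposite arcs *)
  arc_oriented : forall x y, ~~ (arc x y && arc y x);
  weight_gt0 : forall x, (0 < weight x)%N;
  weight_source : forall x, (forall y, ~~ arc y x) -> weight x = 1%N
}.

Definition underlying (V : finType) (D : worgraph V) : rel V :=
  fun x y => arc D x y || arc D y x.

Definition is_sink (V : finType) (D : worgraph V) (x : V) : Prop :=
  forall y, ~~ arc D x y.

Definition Vplus (V : finType) (D : worgraph V) : {set V} :=
  [set x | weight D x != 1%N].

Definition cycle_adj (N : nat) : rel 'I_N :=
  fun i j => (j == ordS i) || (i == ordS j).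

Definition edge_ideal (K : fieldType) (N : nat) (D : worgraph 'I_N) :
    set {mpoly K[N]} :=
  ideal_gen [set f | exists i j, arc D i j /\ f = 'X_i * 'X_j ^+ weight D j].

Arguments edge_ideal K {N} D.

(* Main.v *)
Require Import Defs.
From HB Require Import structures.
From mathcomp Require Import all_boot all_order all_algebra.
From mathcomp Require Import zify.
From mathcomp Require Import mpoly.
From mathcomp Require Import boolp classical_sets constructive_ereal.

(** Write J = I^s and J' = I^(s). After inverting any variable x_i, J and J' agree,
    so J'/J is m-torsion: it is its own H^0_m and has no higher local cohomology.
    Hence H^k_m(J) -> H^k_m(J') is onto for every k, and reg J' <= reg J.

    For the agreement: as the vertices in V^+ are sinks, I is generated by the
    x_i^(w_i) x_j^(w_j) over the edges of the cycle. For a minimal vertex cover C,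
    the prime (x_j : j in C) is associated to I, so a monomial x^a of an element of
    J' satisfies sum_(j in C) floor(a_j / w_j) >= s. Cutting the cycle at i
    leaves a path, on which Koenig's theorem for vertex capacities
    floor(a_j / w_j) provides s edges whose product divides x_i^k x^a for large k. *)

Set Implicit Arguments.
Unset Strict Implicit.
Unset Printing Implicit Defensive.

Import Order.TTheory GRing.Theory Num.Theory.
Local Open Scope classical_set_scope.
Local Open Scope ring_scope.

(** * Suprema in the extended integers *)

(** If no integer is an upper bound, [+oo] is the supremum. Otherwise lower an integer bound [z0] as
    far as possible: an integer [a] of the set stops this after at most [z0 - a] steps. Hence [supz]
    never takes its default value on a nonempty set. *)
Lemma ereal_int_supremums_neq0 (A : set (\bar int)) : supremums A !=set0.
Proof.
case: (pselect (ubound A -oo%E)) => [ubNy|nubNy].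
  by exists -oo%E; split=> // y _; rewrite leNye.
case: (pselect (exists z : int, ubound A z%:E)) => [[z0 ubz0]|noub]; last first.
  exists +oo%E; split=> [y _|y uby]; first by rewrite leey.
  by case: y uby => [z ubz|//|//]; case: noub; exists z.
have [a Aa lta] : exists2 a : int, A a%:E & (a <= z0).
  apply: contrapT => noa; apply: nubNy => -[z Az||]//.
    by case: noa; exists z => //; have := ubz0 _ Az; rewrite lee_fin.
  by move=> /ubz0; rewrite leye_eq.
pose P := fun k : nat => `[< ubound A (z0 - k%:Z)%:E >].
have exP : exists k, P k by exists 0%N; apply/asboolP; rewrite subr0.
have bP k : P k -> (k <= `|z0 - a|)%N.
  by move=> /asboolP /(_ _ Aa); rewrite lee_fin => h; lia.
case: (ex_maxnP exP bP) => k /asboolP ubk maxk.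
exists (z0 - k%:Z)%:E; split=> // -[z ubz|_|/nubNy//]; last by rewrite leey.
rewrite lee_fin leNgt; apply/negP => ltz.
have := maxk (`|z0 - z|)%N; rewrite /P.
have -> : z0 - `|z0 - z|%N%:Z = z by lia.
by move=> /(_ (asboolT ubz)) h; lia.
Qed.

Lemma supz_supremums (A : set (\bar int)) : A !=set0 -> supremums A (supz A).
Proof.
move=> A0; rewrite /supz /supremum ifF; last by apply/negP => /eqP; apply/eqP/set0P.
case: xgetP => [//|none].
by have [y /none] := ereal_int_supremums_neq0 A.
Qed.

Lemma le_supz (A B : set (\bar int)) :
  (forall x, A x -> exists2 y, B y & (x <= y)%E) -> (supz A <= supz B)%E.
Proof.
move=> AB; have [->|/set0P A0] := eqVneq A set0; first by rewrite supz_set0 leNye.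
have [_ lA] := supz_supremums A0; apply: lA => x /AB[y By xy].
have [uB _] := supz_supremums (ex_intro _ y By).
exact: le_trans xy (uB _ By).
Qed.

(** Nonzero ideals of a domain thus have the same [module_dim], so their regularities range over the
    same cohomological indices. *)
Lemma ann_domain (R : idomainType) (I : set R) f : I f -> f != 0 -> ann I = [set 0].
Proof.
move=> If f0; apply/seteqP; split=> [x /(_ _ If)/eqP|x -> g _]; last exact: mul0r.
by rewrite mulf_eq0 (negbTE f0) orbF => /eqP.
Qed.

(** * Cech complexes of two ideals with torsion quotient *)

Section CechComparison.
Variables (K : fieldType) (N : nat).
Local Notation R := {mpoly K[N]}.
Implicit Types (I J : set R) (S : {set 'I_N}).

Lemma cech_loc_subset I J S j : I `<=` J -> cech_loc I S j `<=` cech_loc J S j.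
Proof. by move=> IJ u [f [d [k [/IJ Jf *]]]]; exists f, d, k. Qed.

Lemma cech_subset I J i j : I `<=` J -> cech I i j `<=` cech J i j.
Proof.
move=> IJ c cI S; move: (cI S); case: ifP => // _.
exact: cech_loc_subset.
Qed.

Lemma xprod_neq0 S : xprod K S != 0.
Proof.
by apply/prodf_neq0 => t _; rewrite -msupp_eq0 msuppX.
Qed.

Lemma xprod_homog S : xprod K S \is #|S|.-homog.
Proof.
rewrite /xprod -sum1_card; elim/big_ind2: _ => //; first exact: dhomog1.
  by move=> p d q e hp hq; apply: dhomogM.
by move=> t _; rewrite dhomogX; apply/eqP; apply: mdeg1.
Qed.

(** Expand the fraction [f / x_S ^ k] by [x_S ^ l]: for some [t] in [S], the factor ['X_t ^+ l]
    brings the numerator into [I]. *)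
Lemma cech_loc_subset_torsion I J S j :
  is_ideal I -> (forall f i, J f -> exists k, I ('X_i ^+ k * f)) ->
  S != finset.set0 -> cech_loc J S j `<=` cech_loc I S j.
Proof.
move=> [_ _ mulI] tors /set0Pn[t tS] u [f [d [k [Jf homf dE ->]]]].
have [l Il] := tors f t Jf.
exists (xprod K S ^+ l * f), (#|S| * l + d)%N, (l + k)%N; split.
- rewrite /xprod (bigD1 t tS) /= exprMn [_ ^+ l * _]mulrC -mulrA.
  exact: mulI.
- by apply: dhomogM homf; apply: dhomogMn; apply: xprod_homog.
- by rewrite PoszD dE; lia.
- rewrite tofracM tofracXn exprD invfM [X in _ = X]mulrACA divff ?mul1r //.
  by rewrite expf_neq0 // tofrac_eq0 xprod_neq0.
Qed.

Lemma cech_subset_torsion I J i j :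
  is_ideal I -> (forall f t, J f -> exists k, I ('X_t ^+ k * f)) ->
  cech J i.+1 j `<=` cech I i.+1 j.
Proof.
move=> idI tors c cJ S; move: (cJ S); case: eqP => // cS.
by apply: cech_loc_subset_torsion => //; rewrite -card_gt0 cS.
Qed.

(* The long exact sequence of I -> J -> J/I, where J/I is its own H^0 and has no
   higher local cohomology: H^i(I) -> H^i(J) is onto for every i. *)
Lemma loc_cohom_neq0_torsion I J i j : (0 < N)%N ->
  is_ideal I -> I `<=` J -> (forall f t, J f -> exists k, I ('X_t ^+ k * f)) ->
  loc_cohom_neq0 J i j -> loc_cohom_neq0 I i j.
Proof.
move=> N0 idI IJ tors nJ HI; apply: nJ; case: i HI => [_|i HI] c [cJ dc].
  (* An ideal of a domain has no torsion, so H^0 vanishes: on a singleton the differential is the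
     component at the empty set, up to sign. *)
  apply/funext => S; move: (cJ S); case: eqP => // /cards0_eq -> _.
  have := dc [set Ordinal N0]%SET; rewrite /cech_diff big_set1 finset.setDv.
  by move/eqP; rewrite mulf_eq0 signr_eq0 /= => /eqP.
(* In positive degrees a cocycle of [J] is one of [I], and a cochain of [I] bounding it is also a
   cochain of [J]. *)
have [|c' cI' <-] := HI c; first by split=> //; apply: cech_subset_torsion cJ.
by exists c' => //; apply: cech_subset cI'.
Qed.

Lemma le_reg_torsion I J f : (0 < N)%N -> I f -> f != 0 ->
  is_ideal I -> I `<=` J -> (forall f t, J f -> exists k, I ('X_t ^+ k * f)) ->
  (reg J <= reg I)%E.
Proof.
move=> N0 If f0 idI IJ tors; apply: le_supz => x [i /= ilt <-].
exists (a_inv I i + (i%:Z)%:E)%E.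
  by exists i => //=; rewrite /module_dim (ann_domain If f0) -(ann_domain (IJ _ If) f0).
apply/leeD2r/le_supz => y [j /= nJ <-]; exists j%:E => //.
by exists j => //=; apply: loc_cohom_neq0_torsion nJ.
Qed.

End CechComparison.

(** * Powers of ideals and monomials in ideals *)

Section Ideals.
Variable R : comNzRingType.
Implicit Types (I G : set R).

Lemma ideal_gen_is_ideal G : is_ideal (ideal_gen G).
Proof.
split=> [J [[? ? ?] _]//|x y Gx Gy J [idJ GJ]|a x Gx J [idJ GJ]].
  by case: (idJ) => _ D _; apply: D; [apply: Gx|apply: Gy].
by case: (idJ) => _ _ M; apply: M; apply: Gx.
Qed.

Lemma ideal_power_is_ideal I s : is_ideal (ideal_power I s).
Proof. exact: ideal_gen_is_ideal. Qed.

Lemma prod_ideal_power I s (l : seq R) :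
  (forall f, f \in l -> I f) -> (s <= size l)%N ->
  ideal_power I s (\prod_(f <- l) f).
Proof.
move=> Il sl; rewrite -(cat_take_drop s l) big_cat /= [_ * _]mulrC.
have [_ _ M] := ideal_power_is_ideal I s; apply: M.
apply: sub_gen_smallest; exists (fun k : 'I_s => nth 0 l k).
  by move=> k; apply/Il/mem_nth/(leq_trans (ltn_ord k)).
rewrite -(big_mkord xpredT (nth 0 l)).
rewrite [RHS](big_nth 0) size_takel // !big_nat; apply: eq_bigr => k.
by move=> /andP[_ ks]; rewrite nth_take.
Qed.

End Ideals.

Lemma ideal_power_subset_symbolic (R : idomainType) (I : set R) s :
  ideal_power I s `<=` symbolic_power I s.
Proof.
move=> f If p [[_ p1 _] _]; exists f, 1; split=> //.
by rewrite tofrac1 divr1.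
Qed.

Lemma ideal_monomial (K : fieldType) N (I : set {mpoly K[N]}) m m' :
  is_ideal I -> (m <= m')%MM -> I 'X_[m] -> I 'X_[m'].
Proof. by move=> [_ _ mulI] mm' Im; rewrite -(submK mm') mpolyXD; apply: mulI. Qed.

Lemma ideal_msupp (K : fieldType) N (I : set {mpoly K[N]}) f :
  is_ideal I -> (forall m, m \in msupp f -> I 'X_[m]) -> I f.
Proof.
move=> [I0 addI mulI] If; rewrite [f]mpolyE big_seq.
elim/big_ind: _ => // m mf; rewrite -mul_mpolyC; apply: mulI; exact: If.
Qed.

(** * Powers of irreducible monomial ideals *)

Section Primary.
Variables (K : fieldType) (N : nat) (w : 'I_N -> nat) (C : {set 'I_N}).
Local Notation R := {mpoly K[N]}.
Implicit Types (f g u : R) (m : 'X_{1..N}).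

(** For positive weights, the largest t such that the monomial is divisible by a product of t
    generators [x_j ^ w_j], [j] in [C]. *)
Definition wdeg m : nat := \sum_(j in C) m j %/ w j.

(* The s-th power of the irreducible ideal generated by the [x_j ^ w_j] with
   [j] in [C], described by its monomials. *)
Definition primary_power s : set R := [set f | forall m, m \in msupp f -> (s <= wdeg m)%N].

Lemma wdegD m m' : (wdeg m + wdeg m' <= wdeg (m + m')%MM)%N.
Proof.
rewrite -big_split; apply: leq_sum => j _; rewrite mnmDE.
have [->|w0] := posnP (w j); first by rewrite !divn0.
by rewrite divnD // leq_addr.
Qed.

Lemma primary_powerM s t f g :
  primary_power s f -> primary_power t g -> primary_power (s + t) (f * g).
Proof.
move=> Qf Qg m /msuppM_le/allpairsP[[a b] /= [/Qf sa /Qg tb ->]].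
by apply: leq_trans (wdegD a b); apply: leq_add.
Qed.

Lemma primary_power_is_ideal s : is_ideal (primary_power s).
Proof.
split=> [m|f g Qf Qg m /msuppD_le|a f Qf].
- by rewrite msupp0.
- by rewrite mem_cat => /orP[/Qf|/Qg].
- by rewrite -(add0n s); apply: primary_powerM.
Qed.

Lemma ideal_power_primary (I : set R) s :
  I `<=` primary_power 1 -> ideal_power I s `<=` primary_power s.
Proof.
move=> IQ; apply: smallest_sub; first exact: primary_power_is_ideal.
move=> _ [f If <-]; rewrite -[s in primary_power s]card_ord -sum1_card.
elim/big_ind2: _ => // [g t h r ? ?|k _]; first exact: primary_powerM.
exact/IQ/If.
Qed.

End Primary.

Lemma exists_min_seq (T : eqType) (r : rel T) (s : seq T) :
  total r -> transitive r -> s != [::] -> exists2 x, x \in s & forall y, y \in s -> r x y.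
Proof.
move=> tot tr s0; have := sort_sorted tot s; have := mem_sort r s.
case: (sort r s) => [|x t] ms srt; first by case: s s0 ms {srt} => // x s _ /(_ x); rewrite mem_head.
exists x => [|y]; rewrite -ms ?mem_head // in_cons => /predU1P[->|].
  by have := tot x x; rewrite orbb.
by apply/allP: y; apply: order_path_min.
Qed.

(** * The primary property and localization at the prime of a cover *)

Section PrimaryPrime.
Variables (K : fieldType) (N : nat) (C : {set 'I_N}).
Local Notation R := {mpoly K[N]}.
Implicit Types (f g u : R) (m : 'X_{1..N}).

Definition cover_prime : set R := primary_power (fun=> 1%N) C 1.

Definition cdeg m : nat := \sum_(j in C) m j.

Lemma cdegD m m' : cdeg (m + m')%MM = (cdeg m + cdeg m')%N.
Proof. by rewrite -big_split; apply: eq_bigr => j _; rewrite mnmDE. Qed.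

(** The degree in the variables of [C] is compared first, so that the least monomial of a polynomial
    outside [cover_prime] avoids [C]. *)
Definition cle m m' := (cdeg m < cdeg m')%N || (cdeg m == cdeg m') && (m <= m')%O.

Lemma cle_total : total cle.
Proof.
move=> a b; rewrite /cle; case: ltngtP => //= _; exact: le_total.
Qed.

Lemma cle_trans : transitive cle.
Proof.
move=> b a c; rewrite /cle => /orP[ab|/andP[/eqP-> ab]] /orP[bc|/andP[/eqP<- bc]].
- by rewrite (ltn_trans ab bc).
- by rewrite ab.
- by rewrite bc.
- by rewrite eqxx (le_trans ab bc) orbT.
Qed.

Lemma cle_addI a b a' b' : cle a a' -> cle b b' -> (a + b = a' + b')%MM -> a = a' /\ b = b'.
Proof.
move=> aa bb E; have := congr1 cdeg E; rewrite !cdegD.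
move: aa bb; rewrite /cle => /orP[la|/andP[/eqP ca la]] /orP[lb|/andP[/eqP cb lb]] cE; try lia.
have [ea|na] := eqVneq a a'.
  by split=> //; move: E; rewrite ea => /addmI.
have lta : (a < a')%O by rewrite lt_neqAle na.
by have := ltmc_le_add lta lb; rewrite E ltxx.
Qed.

(* The product of the two least bad monomials, for the monomial order [cle], does
   not cancel in [u * f]. *)
Lemma primary_power_primary w s u f :
  ~ cover_prime u -> primary_power w C s (u * f) -> primary_power w C s f.
Proof.
move=> Cu Quf; apply: contrapT => Qf.
pose badf := [seq m <- msupp f | (wdeg w C m < s)%N].
have badf0 : badf != [::].
  apply/eqP => badf0; apply: Qf => m mf; rewrite leqNgt; apply/negP => ms.
  by have : m \in badf; [rewrite mem_filter ms mf|rewrite badf0].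
have supu0 : msupp u != [::].
  by apply/eqP => u0; apply: Cu => m; rewrite u0.
have [a] := exists_min_seq cle_total cle_trans badf0.
rewrite mem_filter => /andP[abad af] amin.
have [b bu bmin] := exists_min_seq cle_total cle_trans supu0.
have b0 j : j \in C -> b j = 0%N.
  have [b' b'u b'0] : exists2 b', b' \in msupp u & cdeg b' = 0%N.
    apply: contrapT => H; apply: Cu => m mu; rewrite /wdeg.
    under eq_bigr do rewrite divn1.
    by rewrite lt0n; apply/eqP => m0; apply: H; exists m.
  move=> jC; have := bmin _ b'u; rewrite /cle b'0 ltn0 /= => /andP[/eqP + _].
  by move=> /eqP; rewrite sum_nat_eq0 => /forall_inP/(_ _ jC)/eqP.
have wab : wdeg w C (b + a)%MM = wdeg w C a.
  by apply: eq_bigr => j jC; rewrite mnmDE b0.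
have: (b + a)%MM \in msupp (u * f); last first.
  by move=> /Quf; rewrite wab leqNgt abad.
rewrite mcoeff_msupp mcoeffM.
have ba1 : (mdeg b < (mdeg (b + a)%MM).+1)%N by rewrite mdegD ltnS leq_addr.
have ba2 : (mdeg a < (mdeg (b + a)%MM).+1)%N by rewrite mdegD ltnS leq_addl.
rewrite (bigD1 (BMultinom ba1, BMultinom ba2)) //= big1 ?addr0; last first.
  move=> [b' a'] /= /andP[/eqP E ne].
  have [b'u|/memN_msupp_eq0->] := boolP (bmnm b' \in msupp u); last by rewrite mul0r.
  have [a'f|/memN_msupp_eq0->] := boolP (bmnm a' \in msupp f); last by rewrite mulr0.
  (* By superadditivity [wdeg] of [a'] is at most that of [b + a], which is below [s]. Minimality of
     [a] and [b] then excludes any second pair with the same product. *)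
  have a'bad : bmnm a' \in badf.
    rewrite mem_filter a'f andbT; apply: leq_ltn_trans abad.
    by rewrite -wab (congr1 (wdeg w C) E); apply: leq_trans (wdegD w C b' a'); rewrite leq_addl.
  have [eb ea] := cle_addI (bmin _ b'u) (amin _ a'bad) E.
  by case/negP: ne; apply/eqP; congr pair; apply: val_inj.
by rewrite mulf_neq0 // -mcoeff_msupp.
Qed.

Lemma cover_prime_is_prime : is_prime_ideal cover_prime.
Proof.
split; first exact: primary_power_is_ideal.
  move=> /(_ 0%MM); rewrite msupp1 mem_head => /(_ isT).
  by rewrite /wdeg big1 // => j _; rewrite mnm0E.
move=> x y xy; case: (pselect (cover_prime x)) => [|Cx]; [by left|right].
exact: primary_power_primary Cx xy.
Qed.

(** Membership after localization means that [u * f] lies in the ordinary power for some [u] outside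
    the prime; the primary property removes [u]. *)
Lemma symbolic_power_primary (I : set R) w s :
  I `<=` primary_power w C 1 -> Ass I cover_prime ->
  symbolic_power I s `<=` primary_power w C s.
Proof.
move=> IQ AssC f /(_ _ AssC)[g [u [Ig Cu fE]]].
have u0 : u != 0.
  by apply/eqP => u0; apply: Cu; rewrite u0; case: (primary_power_is_ideal K (fun=> 1%N) C 1).
apply: (primary_power_primary Cu).
suff -> : u * f = g by apply: ideal_power_primary Ig.
apply/eqP; rewrite -tofrac_eq tofracM fE mulrCA divff ?mulr1 //.
by rewrite tofrac_eq0.
Qed.

End PrimaryPrime.

(* Koenig's theorem for the path 0, ..., m with vertex capacities [c]: [e k] is
   the multiplicity of the edge {k, k+1}. *)
Lemma path_konig (m : nat) (c : nat -> nat) :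
  exists (e : nat -> nat) (C : pred nat),
    [/\ (e 0 <= c 0)%N, forall k, (k < m)%N -> (e k + e k.+1 <= c k.+1)%N, e m = 0%N,
        forall k, (k < m)%N -> C k || C k.+1
      & (\sum_(0 <= k < m.+1 | C k) c k <= \sum_(0 <= k < m) e k)%N].
Proof.
elim: m c => [|m IHm] c.
  by exists (fun=> 0%N), xpred0; split=> //; rewrite big_pred0.
(* Greedy choice: the first edge is used as often as possible, and [c'] holds what remains on the
   path from vertex 1. *)
pose x := minn (c 0%N) (c 1%N).
pose c' k := if k is 0 then (c 1 - x)%N else c k.+1.
have [e' [C' [e0 eS em cov sumC]]] := IHm c'.
have xc0 : (x <= c 0)%N by rewrite geq_minl.
have xc1 : (x <= c 1)%N by rewrite geq_minr.
exists (fun k => if k is k'.+1 then e' k' else x).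
(* The edge {0, 1} is covered by its exhausted end unless [C'] already contains vertex 1; in every
   case the capacity of the cover grows by exactly [x]. *)
exists (fun k => if k is k'.+1 then C' k' || (k' == 0) && (c 1 <= c 0) else ~~ C' 0 && (c 0 < c 1))%N.
split=> //.
- case=> [_|k km] /=; first by move: e0; rewrite /c'; lia.
  exact: (eS k km).
- case=> [_|k km] /=; first by case: (C' 0%N) => //=; case: ltnP.
  have := cov k km; case: (C' k) => //= ->; by rewrite orbT.
rewrite big_mkcond !big_nat_recl //=.
under eq_bigr do rewrite orbF.
move: sumC; rewrite big_mkcond big_nat_recl //= => sumC.
rewrite /x in sumC *; case: (C' 0%N) sumC => /=; case: ltnP => /=; lia.
Qed.

Lemma leq_sum_imset (I J : finType) (h : I -> J) (A : {set I}) (F : J -> nat) :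
  (\sum_(j in h @: A) F j <= \sum_(i in A) F (h i))%N.
Proof.
rewrite [leqRHS](partition_big_imset h); apply: leq_sum => _ /imsetP[i iA ->].
by rewrite (bigD1 i) ?iA ?eqxx //= leq_addr.
Qed.

(** * Vertex covers and edge multiplicities on a cycle *)

Section Cycle.
Variable N : nat.
Implicit Types (i j : 'I_N.+1) (C : {set 'I_N.+1}).

Definition cycle_walk i (k : nat) : 'I_N.+1 := inord ((i + k) %% N.+1).

Lemma cycle_walkS i k : cycle_walk i k.+1 = ordS (cycle_walk i k).
Proof.
apply: val_inj; rewrite /= !inordK ?ltn_pmod //.
by rewrite addnS -addn1 -[in RHS]addn1 modnDml.
Qed.

Lemma cycle_walk0 i : cycle_walk i 0 = i.
Proof. by apply: val_inj; rewrite /= inordK ?ltn_pmod // addn0 modn_small. Qed.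

Lemma cycle_walk_loop i : cycle_walk i N.+1 = i.
Proof.
by apply: val_inj; rewrite /= inordK ?ltn_pmod // modnDr modn_small.
Qed.

Lemma cycle_walk_inj i : {in (fun k => (k < N.+1)%N) &, injective (cycle_walk i)}.
Proof.
move=> k k' kN k'N /(congr1 val); rewrite /= !inordK ?ltn_pmod // => /eqP.
by rewrite eqn_modDl !modn_small // => /eqP.
Qed.

Lemma cycle_walk_surj i j : exists2 k, (k < N.+1)%N & cycle_walk i k = j.
Proof.
exists ((j + (N.+1 - i)) %% N.+1)%N; first by rewrite ltn_pmod.
apply: val_inj; rewrite /= inordK ?ltn_pmod // modnDmr addnCA subnKC; last exact/ltnW.
by rewrite modnDr modn_small.
Qed.

Definition cycle_cover C := [forall j, (j \in C) || (ordS j \in C)].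

(** If all neighbours of [j] were in [C], then [j] could be removed; [0 < N] ensures that [j] is not
    its own neighbour. *)
Lemma cycle_cover_minimal C j : (0 < N)%N -> minset cycle_cover C -> j \in C ->
  exists2 i, i \notin C & cycle_adj i j.
Proof.
move=> N0 minC jC; apply: contrapT => noi.
have inC i : cycle_adj i j -> i \in C.
  by move=> ij; apply: contrapT => /negP iC; apply: noi; exists i.
have ordS_neq (k : 'I_N.+1) : ordS k != k.
  apply/eqP => /(congr1 val) /=; have := ltn_ord k; rewrite ltnS leq_eqVlt.
  case/predU1P => [->|kN]; first by rewrite modnn; lia.
  by rewrite modn_small //; lia.
case/minsetP: (minC) => /forallP covC min.
suff /min/(_ (subD1set C j))/setP/(_ j) : cycle_cover (C :\ j)%SET by rewrite !inE eqxx jC.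
apply/forallP => k; rewrite !inE.
have [->|kj] /= := eqVneq k j.
  by rewrite ordS_neq /= inC // /cycle_adj eqxx orbT.
have [kj'|_] /= := eqVneq (ordS k) j; last exact: covC.
by rewrite orbF inC // /cycle_adj kj' eqxx.
Qed.

(* Cutting the cycle at [i] yields a path from [i] to [i], to which Koenig's
   theorem applies; the capacity of [i] is in effect infinite. *)
Lemma cycle_matching (b : 'I_N.+1 -> nat) (s : nat) i :
  (forall C, cycle_cover C -> (s <= \sum_(j in C) b j)%N) ->
  exists e : nat -> nat, (s <= \sum_(0 <= k < N.+1) e k)%N /\
    forall j, j != i ->
      (\sum_(0 <= k < N.+1) e k * ((cycle_walk i k == j) + (cycle_walk i k.+1 == j)) <= b j)%N.
Proof.
move=> bs.
(* Capacity [s] at both copies of [i] suffices: a cover of the path containing either copy already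
   has capacity at least [s]. *)
pose c k := if (k == 0)%N || (k == N.+1) then s else b (cycle_walk i k).
have [e [C [e0 eS _ cov sumC]]] := path_konig N.+1 c.
exists e; split.
  apply: leq_trans sumC; rewrite big_mkord.
  have [C0|nC0] := boolP (C 0%N).
    by rewrite (bigD1 ord0) //= /c /= leq_addr.
  have [CN|nCN] := boolP (C N.+1).
    by rewrite (bigD1 ord_max) //= /c eqxx leq_addr.
  (* A cover of the path avoiding both copies of [i] projects to a cover of the cycle, where the
     hypothesis on [b] applies. *)
  pose A := [set k : 'I_N.+2 | C k]%SET.
  have covA : cycle_cover ((fun k : 'I_N.+2 => cycle_walk i k) @: A).
    apply/forallP => j; have [k kN <-] := cycle_walk_surj i j; rewrite -cycle_walkS.
    apply/orP; case/orP: (cov k kN) => Ck; [left|right]; apply/imsetP.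
      by exists (Ordinal (leqW kN)); rewrite ?inE.
    by exists (@Ordinal N.+2 k.+1 kN); rewrite ?inE.
  apply: leq_trans (bs _ covA) _; apply: leq_trans (leq_sum_imset _ _ _) _.
  rewrite (eq_bigl (fun k : 'I_N.+2 => C k)) => [|k]; last by rewrite inE.
  apply: leq_sum => k Ck; rewrite /c ifF //; apply/negbTE; rewrite negb_or.
  by apply/andP; split; apply/eqP => E; rewrite E ?(negbTE nC0) ?(negbTE nCN) in Ck.
move=> j ji; have [[|k] kN kj] := cycle_walk_surj i j.
  by rewrite -kj cycle_walk0 eqxx in ji.
(* Here [j] is the vertex [k.+1] of the walk, so only the edges [k] and [k.+1] meet it. *)
apply: (@leq_trans (e k + e k.+1)); last first.
  apply: leq_trans (eS k (ltnW kN)) _; rewrite /c /= -kj ifF //.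
  by apply/negbTE; rewrite neq_ltn kN.
under eq_bigr do rewrite mulnDr.
rewrite big_split [leqRHS]addnC /= !big_mkord; apply: leq_add; last first.
  rewrite (bigD1 (Ordinal (ltnW kN))) //= kj eqxx muln1 big1 ?addn0 // => l /eqP lk.
  case: eqP => [E|_]; last by rewrite muln0.
  have [lN|] := ltnP l.+1 N.+1.
    have := @cycle_walk_inj i l.+1 k.+1 lN kN; rewrite E kj => /(_ erefl)[lk'].
    by case: lk; apply: val_inj.
  rewrite ltnS => Nl; have lN : l.+1 = N.+1 by have := ltn_ord l; lia.
  by move: E ji; rewrite lN cycle_walk_loop => ->; rewrite eqxx.
rewrite (bigD1 (Ordinal kN)) //= kj eqxx muln1 big1 ?addn0 // => l /eqP lk.
case: eqP => [E|_]; last by rewrite muln0.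
have := @cycle_walk_inj i l k.+1 (ltn_ord l) kN; rewrite E kj => /(_ erefl) lk'.
by case: lk; apply: val_inj.
Qed.

End Cycle.

(** * The edge ideal of the oriented cycle *)

Section OrientedCycle.
Variables (K : fieldType) (N : nat) (D : worgraph 'I_N.+1).
Hypothesis N_gt0 : (0 < N)%N.
Hypothesis D_cycle : forall i j, underlying D i j = cycle_adj i j.
Hypothesis Vplus_sink : forall x, x \in Vplus D -> is_sink D x.
Local Notation R := {mpoly K[N.+1]}.
Local Notation w := (weight D).
Local Notation I := (edge_ideal K D).

(** Symmetric in the two ends, which makes the orientation disappear from the generators. *)
Definition edge_mnm i j : 'X_{1..N.+1} := (U_(i) *+ w i + U_(j) *+ w j)%MM.

Lemma edge_mnmE i j k : edge_mnm i j k = (w k * ((i == k) + (j == k)))%N.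
Proof.
rewrite mnmDE !mulmnE !mnm1E mulnDr.
by congr addn; case: eqP => [->|_]; rewrite ?mul0n ?muln0 // mul1n muln1.
Qed.

(* The tail of an arc is not a sink, hence has weight 1. *)
Lemma arc_mnm i j : Defs.arc D i j -> 'X_i * 'X_j ^+ w j = 'X_[edge_mnm i j] :> R.
Proof.
move=> ij; rewrite mpolyXD -!mpolyXn.
suff -> : w i = 1%N by rewrite expr1.
apply/eqP; apply: contraT => wi.
by have /Vplus_sink/(_ j) : i \in Vplus D; rewrite ?inE // ij.
Qed.

Lemma edge_ideal_is_ideal : is_ideal I.
Proof. exact: ideal_gen_is_ideal. Qed.

Lemma edge_mnm_in i j : cycle_adj i j -> I 'X_[edge_mnm i j].
Proof.
rewrite -D_cycle => /orP[ij|ji]; apply: sub_gen_smallest.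
  by exists i, j; split=> //; rewrite arc_mnm.
by exists j, i; split=> //; rewrite arc_mnm // /edge_mnm addmC.
Qed.

Lemma edge_ideal_primary C : cycle_cover C -> I `<=` primary_power w C 1.
Proof.
move=> /forallP covC; apply: smallest_sub; first exact: primary_power_is_ideal.
move=> _ [i [j [ij ->]]] m; rewrite arc_mnm // msuppX mem_seq1 => /eqP->.
have [k kC kij] : exists2 k, k \in C & (i == k) || (j == k).
  have : cycle_adj i j by rewrite -D_cycle /underlying ij.
  case/orP => /eqP E; have := covC i; have := covC j; rewrite -E.
    by move=> _ /orP[iC|jC]; [exists i|exists j]; rewrite ?eqxx ?orbT.
  by move=> /orP[jC|iC] _; [exists j|exists i]; rewrite ?eqxx ?orbT.
rewrite /wdeg (bigD1 k) //= ltn_addr // divn_gt0 ?weight_gt0 // edge_mnmE.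
by case: (i == k) (j == k) kij => -[] //= _; rewrite leq_pmulr.
Qed.

Lemma Ass_cover_prime C : minset (@cycle_cover N) C -> Ass I (cover_prime C).
Proof.
move=> minC; split; first exact: cover_prime_is_prime.
have covC : cycle_cover C by case/minsetP: minC.
(* Each variable of [C] is one step short of its weight. Multiplying by [x_j] with [j] in [C]
   completes the edge to a neighbour outside [C], given by minimality; a multiplier monomial without
   variables of [C] leaves [wdeg] at 0. *)
pose g := [multinom (if j \in C then (w j).-1 else w j) | j < N.+1].
exists 'X_[g]; apply/seteqP; split=> [f Cf|f].
  apply: ideal_msupp edge_ideal_is_ideal _ => m.
  rewrite (perm_mem (msuppMX _ _)) => /mapP[m' /Cf + ->].
  rewrite lt0n sum_nat_eq0 negb_forall_in => /exists_inP[j jC].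
  rewrite divn1 -lt0n => m'j.
  have [i iC ij] := cycle_cover_minimal N_gt0 minC jC.
  apply: ideal_monomial edge_ideal_is_ideal _ (edge_mnm_in ij).
  apply/mnm_lepP => k; rewrite edge_mnmE mnmDE mnmE.
  have [ik|_] := eqVneq i k; have [jk|_] := eqVneq j k.
  - by move: iC; rewrite ik -jk jC.
  - by rewrite -ik (negbTE iC) muln1 leq_addr.
  - by rewrite -jk jC muln1; have := weight_gt0 D j; lia.
  - by rewrite muln0.
move=> /edge_ideal_primary -/(_ _ covC) fg m mf.
have /fg : (g + m)%MM \in msupp (f * 'X_[g]).
  by rewrite (perm_mem (msuppMX _ _)) map_f.
rewrite !lt0n !sum_nat_eq0; apply: contra => /forall_inP m0.
apply/forall_inP => j jC; have := m0 j jC; rewrite divn1 => /eqP mj.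
by rewrite mnmDE mj addn0 mnmE jC divn_small // prednK ?weight_gt0.
Qed.

(** A minimal cover inside [C] has an associated prime, and enlarging it to [C] can only increase
    [wdeg]. *)
Lemma symbolic_power_cover f s C : cycle_cover C ->
  symbolic_power I s f -> primary_power w C s f.
Proof.
move=> covC If; have [B minB BC] := minset_exists covC.
have covB : cycle_cover B by case/minsetP: minB.
have := symbolic_power_primary (edge_ideal_primary covB) (Ass_cover_prime minB) If.
move=> Qf m /Qf sB; apply: leq_trans sB _.
rewrite /wdeg [leqRHS](big_setID B) /= (finset.setIidPr BC); exact: leq_addr.
Qed.

Lemma symbolic_power_monomial (a : 'X_{1..N.+1}) s i :
  (forall C, cycle_cover C -> (s <= wdeg w C a)%N) ->
  exists k, ideal_power I s 'X_[U_(i) *+ k + a].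
Proof.
move=> /(@cycle_matching _ (fun j => a j %/ w j)%N _ i)[e [se eb]].
pose v := cycle_walk i.
pose l := flatten [seq nseq (e k) ('X_[edge_mnm (v k) (v k.+1)] : R) | k <- iota 0 N.+1].
pose p := (\sum_(0 <= k < N.+1) edge_mnm (v k) (v k.+1) *+ e k)%MM.
have prodl : \prod_(f <- l) f = 'X_[p].
  rewrite big_flatten big_map /p -mprodXnE; apply: eq_bigr => k _.
  by rewrite big_nseq -Monoid.iteropE.
have pE j : p j = (w j * \sum_(0 <= k < N.+1) e k * ((v k == j) + (v k.+1 == j)))%N.
  rewrite mnm_sumE big_distrr /=; apply: eq_bigr => k _.
  by rewrite mulmnE edge_mnmE; lia.
(* The power of [x_i] supplies all that the chosen edges need at [i]; at the other vertices the
   capacities bound their exponents by those of [a]. *)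
exists (p i); apply: (@ideal_monomial _ _ _ p _ (ideal_power_is_ideal I s)).
  apply/mnm_lepP => j; rewrite mnmDE mulmnE mnm1E.
  have [<-|ij] := eqVneq i j; first by rewrite mul1n leq_addr.
  rewrite mul0n pE mulnC -leq_divRL ?weight_gt0 //; apply: eb.
  by rewrite eq_sym.
rewrite -prodl; apply: prod_ideal_power.
  move=> f /flattenP[_ /mapP[k _ ->]]; rewrite mem_nseq => /andP[_ /eqP->].
  by apply: edge_mnm_in; rewrite /cycle_adj -cycle_walkS eqxx.
rewrite size_flatten /shape -map_comp sumnE big_map.
by under eq_bigr do rewrite /= size_nseq.
Qed.

Lemma symbolic_power_torsion s f i : symbolic_power I s f ->
  exists k, ideal_power I s ('X_i ^+ k * f).
Proof.
move=> If; have idP := ideal_power_is_ideal I s.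
have H m : m \in msupp f -> exists k, ideal_power I s 'X_[U_(i) *+ k + m].
  move=> mf; apply: symbolic_power_monomial => C covC.
  exact: symbolic_power_cover covC If m mf.
pose k_ m := xget 0%N [set k | ideal_power I s 'X_[U_(i) *+ k + m]].
(* The support is finite, so one exponent serves all monomials of [f]. *)
exists (\max_(m <- msupp f) k_ m)%N.
rewrite mulrC mpolyXn; apply: ideal_msupp => // m.
rewrite (perm_mem (msuppMX _ _)) => /mapP[m' m'f ->].
apply: (@ideal_monomial _ _ _ (U_(i) *+ k_ m' + m')%MM _ idP).
  apply/mnm_lepP => j; rewrite !mnmDE !mulmnE leq_add2r leq_mul2l.
  by apply/orP; right; apply: leq_bigmax_seq.
by rewrite /k_; case: xgetP => // none; have [k /none] := H _ m'f.
Qed.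

Lemma le_reg_symbolic_power s :
  (reg (symbolic_power I s) <= reg (ideal_power I s))%E.
Proof.
(* The s-th power of an edge monomial is a nonzero element of the ordinary power. *)
pose x : R := 'X_[edge_mnm ord0 (ordS ord0)].
apply: (@le_reg_torsion _ _ _ _ (\prod_(f <- nseq s x) f)) => //.
- apply: prod_ideal_power; last by rewrite size_nseq.
  move=> f; rewrite mem_nseq => /andP[_ /eqP->].
  by apply: edge_mnm_in; rewrite /cycle_adj eqxx.
- rewrite big_nseq -Monoid.iteropE; apply: expf_neq0.
  by rewrite /x -msupp_eq0 msuppX.
- exact: ideal_power_is_ideal.
- exact: ideal_power_subset_symbolic.
- by move=> f t; apply: symbolic_power_torsion.
Qed.

End OrientedCycle.

Theorem theorem4p3 (K : fieldType) (n : nat) (D : worgraph 'I_(2 * n).+1)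
    (n_ge1 : (1 <= n)%N)
    (D_cycle : forall i j, underlying D i j = cycle_adj i j)
    (Vplus_neq0 : Vplus D != finset.set0)
    (Vplus_sink : forall x, x \in Vplus D -> is_sink D x)
    (s : nat) (s_ge1 : (1 <= s)%N) :
  (reg (symbolic_power (edge_ideal K D) s)
     <= reg (ideal_power (edge_ideal K D) s))%E.
Proof.
by apply: le_reg_symbolic_power => //; rewrite muln_gt0.
Qed.
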